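(* Let $D$ be a nontrivial strong digraph and $\alpha=(D_v)_{v\in V(D)}$ a family of pairwise vertex-disjoint digraphs. Then $\mathsf{d}_s^-(D[\alpha])\ge \min\{|V(D_v)|: v\in V(D)\}$.
   Context: Digraphs are finite, loopless, without parallel arcs; nontrivial means at least two vertices. A digraph is strong if for every ordered pair $u,v$ there is a directed $uv$-walk. The composition $D[\alpha]$ is obtained from $D$ by replacing each vertex $v$ by the digraph $D_v$ and adding every arc from each vertex of $D_v$ to each vertex of $D_u$ whenever $(v,u)\in A(D)$. $S\subseteq V$ is in-dominating if every vertex not in $S$ has an out-neighbor in $S$; strong in-dominating if moreover the induced subdigraph on $S$ is strong. $\mathsf{d}_s^-$ is the maximum number of classes of a partition of the vertex set into strong in-dominating sets. *)

(* Defs.v *)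
From mathcomp Require Import all_boot.

Set Implicit Arguments.
Unset Strict Implicit.
Unset Printing Implicit Defensive.

(* MathComp world.  Arcs form a relation, so there are no parallel arcs. *)
Record digraph := Digraph {
  vertex :> finType;
  has_arc : rel vertex;
  has_arc_irr : irreflexive has_arc
}.

Arguments has_arc {d}.

Definition nontrivial (D : digraph) : bool := 1 < #|D|.

(* [connect has_arc u v] holds iff some directed walk leads from u to v
   (cf. connectP). *)
Definition strong (D : digraph) : bool :=
  [forall u : D, forall v : D, connect has_arc u v].

Section Induced.

Variables (D : digraph) (S : {set D}).

Let T : finType := {x : D | x \in S}.

Definition induced_arc : rel T := [rel x y | has_arc (val x) (val y)].

Fact induced_arc_irr : irreflexive induced_arc.
Proof. by move=> x; apply: has_arc_irr. Qed.

Definition induced : digraph := Digraph induced_arc_irr.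

End Induced.

Section Composition.

Variables (D : digraph) (alpha : D -> digraph).

(* The members of the family are made vertex-disjoint by tagging: a vertex of
   D[alpha] is a pair of v : D and x : alpha v. *)
Let T : finType := {v : D & alpha v}.

(* [tagged_as p q] is the second component of q, cast to the type of that of p;
   the cast is meaningful only under the guard [tag p == tag q]. *)
Definition composition_arc : rel T := [rel p q |
  has_arc (tag p) (tag q)
  || (tag p == tag q) && has_arc (tagged p) (tagged_as p q)].

Fact composition_arc_irr : irreflexive composition_arc.
Proof.
by case=> v x; rewrite /composition_arc /= tagged_asE !has_arc_irr andbF.
Qed.

Definition composition : digraph := Digraph composition_arc_irr.

(* The default value of the iterated minimum bounds all its arguments, so it is
   irrelevant as soon as D has a vertex. *)
Definition min_order : nat :=
  \big[minn/(\max_(v : D) #|alpha v|)]_(v : D) #|alpha v|.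

End Composition.

Definition in_dominating (D : digraph) (S : {set D}) : bool :=
  [forall u : D, (u \notin S) ==> [exists w in S, has_arc u w]].

Definition strong_in_dominating (D : digraph) (S : {set D}) : bool :=
  in_dominating S && strong (induced S).

Definition strong_in_dominating_partition (D : digraph) (P : {set {set D}}) :
    bool :=
  partition P [set: D] && [forall S in P, strong_in_dominating S].

(* The maximum is 0 when no such partition exists; a nonempty strong digraph
   D always has one, [set [set: D]]. *)
Definition strong_in_domatic_number (D : digraph) : nat :=
  \max_(P : {set {set D}} | strong_in_dominating_partition P) #|P|.

(* Main.v *)
Require Import Defs.
From mathcomp Require Import all_boot.

(** Let k be the least order of the D_v.  Colour the vertices of D[alpha] with
    k colours so that every colour occurs in every D_v.  Each colour class is
    strong in-dominating: every vertex of D has an out-neighbour, and any walk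
    of D of positive length lifts to a walk of the class with arbitrarily
    prescribed end-points above its ends, since all arcs are present between
    D_v and D_w when (v, w) is an arc.  Positive length costs nothing: in a
    nontrivial strong digraph every two vertices, equal or not, are joined by
    such a walk. *)

Lemma bigminn_leq (I : eqType) (r : seq I) (F : I -> nat) (d : nat) (i : I) :
  i \in r -> \big[minn/d]_(j <- r) F j <= F i.
Proof.
elim: r => // j r IHr; rewrite inE big_cons => /predU1P[-> | /IHr leFi].
  exact: geq_minl.
exact: leq_trans (geq_minr _ _) leFi.
Qed.

Lemma min_order_leq (D : digraph) (alpha : D -> digraph) (v : D) :
  min_order alpha <= #|alpha v|.
Proof. by apply: bigminn_leq; rewrite mem_index_enum. Qed.

Lemma strong_has_out_neighbor (D : digraph) (v : D) :
  nontrivial D -> strong D -> exists w : D, has_arc v w.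
Proof.
move=> /card_gt1P[x [y [_ _ neq_xy]]] /forallP/(_ v)/forallP connect_v.
have [u neq_uv] : exists u : D, u != v.
  by have [eq_xv | ?] := eqVneq x v; [exists y; rewrite -eq_xv eq_sym | exists x].
(* Since [u] differs from [v], a walk from [v] to [u] is not empty; its first arc gives the
   out-neighbour. *)
have /connectP[[|w s] /= path_s last_s] := connect_v u.
  by rewrite last_s eqxx in neq_uv.
by exists w; case/andP: path_s.
Qed.

Lemma composition_arc_tag (D : digraph) (alpha : D -> digraph)
    (p q : composition alpha) :
  has_arc (tag p) (tag q) -> has_arc p q.
Proof. by move=> arc_pq; rewrite /= /composition_arc /= arc_pq. Qed.

Section MeetsEveryFactor.

Variables (D : digraph) (alpha : D -> digraph) (S : {set composition alpha}).
Hypothesis S_meets : forall v : D, exists2 p, p \in S & tag p = v.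

(** Only the interior vertices need lifts chosen by [S_meets]. The walk is kept nonempty as
    [v :: s]: an empty one would say nothing about distinct [p] and [q] in the same factor. *)
Lemma connect_induced_lift (v : D) (s : seq D) (p q : induced S) :
  path has_arc (tag (val p)) (v :: s) -> last v s = tag (val q) ->
  connect has_arc p q.
Proof.
elim: s v p => [|w s IHs] v p /andP[arc_pv path_s] last_s.
  by apply/connect1/composition_arc_tag; rewrite -[tag (val q)]last_s.
have [r Sr tag_r] := S_meets v; pose r' : induced S := Sub r Sr.
apply: (@connect_trans _ _ r').
  by apply/connect1/composition_arc_tag; rewrite /= tag_r.
by apply: (IHs w); rewrite //= tag_r.
Qed.

Lemma strong_in_dominating_meets :
  nontrivial D -> strong D -> strong_in_dominating S.
Proof.
move=> nontrivialD strongD; apply/andP; split.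
  apply/forallP=> u; apply/implyP=> _.
  have [w arc_uw] := strong_has_out_neighbor _ (tag u) nontrivialD strongD.
  have [r Sr tag_r] := S_meets w.
  apply/existsP; exists r; rewrite Sr.
  by apply: composition_arc_tag; rewrite tag_r.
apply/forallP=> p; apply/forallP=> q.
(* Leaving through [w] first forces positive length, even if [p] and [q] have the same tag. *)
have [w arc_pw] := strong_has_out_neighbor _ (tag (val p)) nontrivialD strongD.
have /forallP/(_ w)/forallP/(_ (tag (val q)))/connectP[s path_s last_s] := strongD.
by apply: (connect_induced_lift w s); rewrite //= arc_pw.
Qed.

End MeetsEveryFactor.

(** The fibres of [c] form the partition; surjectivity makes them nonempty and pairwise distinct. *)
Lemma leq_strong_in_domatic_number (D : digraph) (I : finType) (c : D -> I) :
    (forall i, exists x, c x = i) ->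
    (forall i, strong_in_dominating (c @^-1: [set i])) ->
  #|I| <= strong_in_domatic_number D.
Proof.
move=> c_surj c_dom; pose P := [set c @^-1: [set i] | i : I].
have fiber_inj : injective (fun i => c @^-1: [set i]).
  move=> i j /setP eq_ij; have [x cx] := c_surj i.
  by have := eq_ij x; rewrite !inE cx eqxx => /esym/eqP.
rewrite -cardsT -(card_imset _ fiber_inj) -/P.
have -> : [set c @^-1: [set i] | i in [set: I]] = P.
  by apply/setP=> A; apply/imsetP/imsetP=> -[i _ ->]; exists i.
apply: (@leq_bigmax_cond _ _ (fun P : {set {set D}} => #|P|)).
apply/andP; split; last by apply/forall_inP=> A /imsetP[i _ ->].
apply/and3P; split.
- apply/eqP/setP=> x; rewrite inE; apply/bigcupP.
  by exists (c @^-1: [set c x]); rewrite ?imset_f // !inE.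
- apply/trivIsetP=> A B /imsetP[i _ ->] /imsetP[j _ ->]; apply: contraR.
  case/pred0Pn=> x; rewrite !inE => /andP[/eqP<- /eqP<-]; exact: eqxx.
- apply/imsetP=> -[i _ /setP fiber0]; have [x cx] := c_surj i.
  by have := fiber0 x; rewrite !inE cx eqxx.
Qed.

Theorem theorem8 (D : digraph) (alpha : D -> digraph)
  (nontrivialD : nontrivial D) (strongD : strong D) :
  min_order alpha <= strong_in_domatic_number (composition alpha).
Proof.
case def_k: (min_order alpha) => [//|k].
(* [inord] sends the ranks beyond [k] to [0]. *)
pose c (p : composition alpha) : 'I_k.+1 := inord (enum_rank (tagged p)).
have c_meets (i : 'I_k.+1) (v : D) : exists2 p, c p = i & tag p = v.
  (* Every factor has at least [k.+1] vertices, so one of rank [i], whose colour is [i]. *)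
  have lt_i : i < #|alpha v|.
    by rewrite (leq_trans (ltn_ord i)) // -def_k min_order_leq.
  exists (Tagged alpha (enum_val (Ordinal lt_i))) => //.
  by rewrite /c /= enum_valK inord_val.
rewrite -[k.+1]card_ord; apply: (leq_strong_in_domatic_number _ _ c) => i.
  have /card_gt0P[v _] : 0 < #|D| by apply: ltnW.
  by have [p cp _] := c_meets i v; exists p.
apply: strong_in_dominating_meets => // v.
by have [p cp tag_p] := c_meets i v; exists p => //; rewrite !inE cp.
Qed.
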